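(* Let $F\in C^1(\mathcal{F})$ be such that $\mathrm{NCP}(F)$ has isolated solutions, let $\delta\in(0,\delta_r]$ be finite, and let $p\ge 1$. For $r\in\mathcal{F}$ define $$H_j(z;r)=\frac{z_j+\chi(z-r)}{\|z-r\|^{p}},\qquad z\in\mathcal{F}\setminus\{r\},\quad j=1,\dots,n,$$ where $$\chi(z)=\begin{cases}\exp\left(1+\dfrac{\delta}{\|z\|-\delta}\right), & \|z\|<\delta,\\ 0, & \|z\|\ge\delta.\end{cases}$$ Then $H$ is a complementarity deflation operator for $\mathrm{NCP}(F)$ (with this choice of $\delta$).
   Context: Let $n\ge 1$, let $\mathcal{F}=\{z\in\mathbb{R}^n: z_i\ge 0 \text{ for all } i\}$, and let $\|\cdot\|$ be a fixed norm on $\mathbb{R}^n$. $C^1(\mathcal{F})$ denotes the continuously differentiable functions $F:\mathcal{F}\to\mathbb{R}^n$. Nonlinear complementarity problem: $\mathrm{NCP}(F)$ is to find $z\in\mathbb{R}^n$ with $0\le z\perp F(z)\ge 0$, i.e. for all $i$: $z_i\ge 0$, $F_i(z)\ge 0$ and $z_iF_i(z)=0$. $\mathrm{NCP}(F)$ has isolated solutions if $\delta_r\in(0,\infty]$, where $\delta_r$ is the infimum of $\|s-t\|$ over pairs of distinct solutions $s,t$ (equal to $\infty$ if there are no two distinct solutions). $\mathrm{sign}$ takes values in $\{-1,0,1\}$. Complementarity deflation operator: suppose $\mathrm{NCP}(F)$ has isolated solutions and fix $\delta\in(0,\delta_r]$. For $s\in\mathcal{F}$ let $B(s,\delta)=\{z\in\mathcal{F}: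 0<\|z-s\|<\delta\}$. $H$ is a complementarity deflation operator for $\mathrm{NCP}(F)$ if it assigns to each $s\in\mathcal{F}$ and $z\in\mathcal{F}\setminus\{s\}$ a vector $H(z;s)\in\mathbb{R}^n$ such that for every $s\in\mathcal{F}$: (i) for every sequence $(z_k)$ in $\mathcal{F}\setminus\{s\}$ converging to $s$, $\liminf_{z_k\to s}|H_j(z_k;s)|>0$ for all $j$; (ii) for all $j$, $\mathrm{sign}[z_j]=\mathrm{sign}[H_j(z;s)]$ for all $z\in\mathcal{F}\setminus B(s,\delta)$ with $z\ne s$, and $\mathrm{sign}[z_j]\le\mathrm{sign}[H_j(z;s)]$ for all $z\in B(s,\delta)$. Limits inferior may equal $+\infty$. *)

(* Defs.v *)
From HB Require Import structures.
From mathcomp Require Import all_boot all_order all_algebra.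
From mathcomp Require Import all_classical all_reals all_analysis.
Import Order.TTheory GRing.Theory Num.Theory.
Import numFieldNormedType.Exports.

Set Implicit Arguments.
Unset Strict Implicit.
Unset Printing Implicit Defensive.

Local Open Scope classical_set_scope.
Local Open Scope ring_scope.

(* Vectors of R^n are row vectors, as in the library's [jacobian].  The
   topology on ['rV[R]_n] is the usual one, independently of the norm [N]
   used to measure distances below. *)

Definition orthant (R : realType) (n : nat) : set 'rV[R]_n :=
  [set z : 'rV[R]_n | forall i, 0 <= z 0 i].
Arguments orthant : clear implicits.

Definition is_norm (R : realType) (n : nat) (N : 'rV[R]_n -> R) : Prop :=
  [/\ forall x y, N (x + y) <= N x + N y,
      forall a x, N (a *: x) = `|a| * N x &
      forall x, N x = 0 -> x = 0].

(* A function on [D] is represented by a total function of which only the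
   values on [D] matter.  Differentiability at a point of [D], possibly a
   boundary point, is Fréchet differentiability relative to [D]; [J x] is the
   transpose of the usual Jacobian matrix since vectors are rows. *)
Definition C1_on (R : realType) (n : nat) (D : set 'rV[R]_n)
    (F : 'rV[R]_n -> 'rV[R]_n) : Prop :=
  exists J : 'rV[R]_n -> 'M[R]_n,
    {within D, continuous J} /\
    forall x, D x ->
      (fun z => F z - F x - (z - x) *m J x)
        =o_ (within D (nbhs x)) (fun z => z - x).

Definition NCP (R : realType) (n : nat) (F : 'rV[R]_n -> 'rV[R]_n) :
    set 'rV[R]_n :=
  [set z : 'rV[R]_n | forall i, [/\ 0 <= z 0 i, 0 <= F z 0 i & z 0 i * F z 0 i = 0]].

(* The infimum of the empty set is [+oo]. *)
Definition NCP_separation (R : realType) (n : nat) (N : 'rV[R]_n -> R)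
    (F : 'rV[R]_n -> 'rV[R]_n) : \bar R :=
  ereal_inf [set d | exists s t, [/\ NCP F s, NCP F t, s <> t &
                                     d = (N (s - t))%:E]].

Definition isolated_solutions (R : realType) (n : nat) (N : 'rV[R]_n -> R)
    (F : 'rV[R]_n -> 'rV[R]_n) : Prop :=
  (0 < NCP_separation N F)%E.

Definition punctured_ball (R : realType) (n : nat) (N : 'rV[R]_n -> R)
    (s : 'rV[R]_n) (delta : \bar R) : set 'rV[R]_n :=
  [set z : 'rV[R]_n | [/\ orthant R n z, 0 < N (z - s) & ((N (z - s))%:E < delta)%E]].

(* [H z s] stands for H(z;s) and is only constrained for [s] in the orthant and
   [z] in the orthant with [z <> s]. *)
Definition complementarity_deflation_operator (R : realType) (n : nat)
    (N : 'rV[R]_n -> R) (F : 'rV[R]_n -> 'rV[R]_n) (delta : \bar R)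
    (H : 'rV[R]_n -> 'rV[R]_n -> 'rV[R]_n) : Prop :=
  [/\ isolated_solutions N F,
      (0 < delta <= NCP_separation N F)%E &
      forall s, orthant R n s ->
        [/\ forall z : nat -> 'rV[R]_n,
              (forall k, orthant R n (z k) /\ z k <> s) ->
              z @ \oo --> s ->
              forall j, (0 < limn_einf (fun k => `|H (z k) s 0 j|%:E))%E,
            forall j z, (orthant R n `\` punctured_ball N s delta) z ->
              z <> s -> Num.sg (z 0 j) = Num.sg (H z s 0 j) &
            forall j z, punctured_ball N s delta z ->
              Num.sg (z 0 j) <= Num.sg (H z s 0 j)]].

Definition chi (R : realType) (n : nat) (N : 'rV[R]_n -> R) (delta : R)
    (z : 'rV[R]_n) : R :=
  if N z < delta then expR (1 + delta / (N z - delta)) else 0.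

Definition bump_deflation (R : realType) (n : nat) (N : 'rV[R]_n -> R)
    (delta p : R) (z r : 'rV[R]_n) : 'rV[R]_n :=
  \row_j ((z 0 j + chi N delta (z - r)) / N (z - r) `^ p).

(* Main.v *)
Require Import Defs.
From HB Require Import structures.
From mathcomp Require Import all_boot all_order all_algebra.
From mathcomp Require Import all_classical all_reals all_analysis.
From mathcomp Require Import lra.
Import Order.TTheory GRing.Theory Num.Theory.
Import numFieldNormedType.Exports.
Local Open Scope classical_set_scope.
Local Open Scope ring_scope.

(** Outside the ball of radius [delta] around [r] the bump vanishes, so [H_j]
    is [z_j] divided by a positive number; inside it the bump is positive, so
    [H_j > 0].  Within distance [delta / 2] of [r] the bump is at least
    [exp (-1)] while the denominator is at most [(delta / 2) ^ p], so [H_j] is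
    bounded below by a positive constant along any sequence tending to [r]. *)

(** The limit inferior is the supremum of the tail infima [einfs u m], and [c] is already below one
    of them. No convergence of [u] is required, and the value [+oo] is allowed. *)
Lemma limn_einf_ge_near (R : realType) (u : (\bar R)^nat) (c : \bar R) :
  (\forall k \near \oo, (c <= u k)%E) -> (c <= limn_einf u)%E.
Proof.
move=> [m _ cu]; rewrite limn_einf_lim.
rewrite (cvg_lim (@ereal_hausdorff R) (@cvg_einfs_sup R u)).
apply: le_ereal_sup_tmp; exists (einfs u m); first by exists m.
by apply: le_ereal_inf_tmp => _ [k mk <-]; exact: cu.
Qed.

Section norm_on_rows.
Context (R : realType) (n : nat) (N : 'rV[R]_n -> R).
Hypothesis normN : is_norm N.

Lemma is_norm0 : N 0 = 0.
Proof. by case: normN => _ NZ _; rewrite -(scale0r 0) NZ normr0 mul0r. Qed.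

(** Subadditivity gives 0 = N(x - x) <= 2 N(x). *)
Lemma is_norm_ge0 x : 0 <= N x.
Proof.
case: normN => ND NZ _.
have := ND x (-1 *: x).
by rewrite NZ normrN1 scaleN1r subrr is_norm0 mul1r -mulr2n pmulrn_lge0.
Qed.

Lemma is_norm_gt0 x : x <> 0 -> 0 < N x.
Proof.
case: normN => _ _ N_eq0 x0; rewrite lt_neqAle is_norm_ge0 andbT eq_sym.
by apply/eqP => /N_eq0.
Qed.

(** Expand [x] in the standard basis and bound each coordinate by the max norm. This half of the
    equivalence of norms suffices to pass from the topology of the rows to [N]. *)
Lemma is_norm_le_mx_norm : exists2 C, 0 < C & forall x, N x <= C * `|x|.
Proof.
case: normN => ND NZ _.
pose C := \sum_(j < n) N 'e_j.
have C_ge0 : 0 <= C by apply: sumr_ge0 => j _; exact: is_norm_ge0.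
(* Adding 1 makes the constant positive even when the sum is empty. *)
exists (C + 1) => [|x]; first lra.
have NxC : N x <= C * `|x|.
  rewrite [in leLHS](row_sum_delta x) mulr_suml.
  elim/big_ind2 : _ => [|a b c d ab cd|j _]; first by rewrite is_norm0.
    by rewrite (le_trans (ND _ _))// lerD.
  rewrite NZ mulrC ler_wpM2l ?is_norm_ge0// [leRHS]mx_normrE.
  exact: (le_bigmax _ (fun ij => `|x ij.1 ij.2|) (ord0, j)).
by rewrite (le_trans NxC)// ler_wpM2r// lerDl.
Qed.

Lemma is_norm_cvg_near (z : nat -> 'rV[R]_n) (s : 'rV[R]_n) (e : R) : 0 < e ->
  z @ \oo --> s -> \forall k \near \oo, N (z k - s) < e.
Proof.
move=> e0 zs; have [C C0 NC] := is_norm_le_mx_norm.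
have {}zs : (z k - s) @[k --> \oo] --> (0 : 'rV[R]_n) by apply/subr_cvg0.
near=> k; rewrite (le_lt_trans (NC _))// mulrC -ltr_pdivlMr//.
by near: k; apply: cvgr0_norm_lt; rewrite ?divr_gt0.
Unshelve. all: by end_near. Qed.

End norm_on_rows.

Section bump.
Context (R : realType) (n : nat) (N : 'rV[R]_n -> R) (delta : R).

Lemma chi_gt0 x : N x < delta -> 0 < chi N delta x.
Proof. by move=> xd; rewrite /chi xd expR_gt0. Qed.

Lemma chi_eq0 x : delta <= N x -> chi N delta x = 0.
Proof. by move=> dx; rewrite /chi ltNge dx. Qed.

Lemma chi_near_center x : 0 < delta -> N x <= delta / 2 ->
  expR (-1) <= chi N delta x.
Proof.
move=> d0 xd; have xd' : N x < delta by lra.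
(* The exponent becomes 1 - delta / (delta - N x), whose denominator is at least delta / 2. *)
rewrite /chi xd' ler_expR -[_ - delta]opprB invrN mulrN.
have : delta / (delta - N x) <= 2 by rewrite ler_pdivrMr; lra.
lra.
Qed.

End bump.

Lemma bump_deflation_sg_far (R : realType) (n : nat) (N : 'rV[R]_n -> R)
    (delta p : R) (z s : 'rV[R]_n) (j : 'I_n) :
  0 < N (z - s) -> delta <= N (z - s) ->
  Num.sg (bump_deflation N delta p z s 0 j) = Num.sg (z 0 j).
Proof.
move=> zs0 dzs; rewrite mxE chi_eq0// addr0 sgrM (@gtr0_sg _ (_^-1)) ?mulr1//.
by rewrite invr_gt0 powR_gt0.
Qed.

Lemma bump_deflation_gt0 (R : realType) (n : nat) (N : 'rV[R]_n -> R)
    (delta p : R) (z s : 'rV[R]_n) (j : 'I_n) : orthant R n z ->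
  0 < N (z - s) -> N (z - s) < delta -> 0 < bump_deflation N delta p z s 0 j.
Proof.
by move=> z0 zs0 zsd; rewrite mxE divr_gt0 ?powR_gt0// ltr_wpDl ?chi_gt0 ?z0.
Qed.

Lemma bump_deflation_near_center (R : realType) (n : nat) (N : 'rV[R]_n -> R)
    (delta p : R) (z s : 'rV[R]_n) (j : 'I_n) : 0 < delta -> 0 <= p ->
  orthant R n z -> 0 < N (z - s) -> N (z - s) <= delta / 2 ->
  expR (-1) / (delta / 2) `^ p <= bump_deflation N delta p z s 0 j.
Proof.
move=> d0 p0 z0 zs0 zsd; rewrite mxE ler_pM ?expR_ge0 ?invr_ge0 ?powR_ge0//.
  by rewrite (le_trans (chi_near_center _ _ _ _ _ d0 zsd))// lerDr z0.
rewrite lef_pV2 ?posrE ?powR_gt0 ?divr_gt0//.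
(* As [p] is nonnegative, the power is monotone in its base. *)
by apply: ge0_ler_powR => //; rewrite nnegrE ltW ?divr_gt0.
Qed.

Theorem lemma3p5 (R : realType) (n : nat) (hn : (1 <= n)%N)
    (N : 'rV[R]_n -> R) (hN : is_norm N)
    (F : 'rV[R]_n -> 'rV[R]_n) (hF : C1_on (orthant R n) F)
    (hiso : isolated_solutions N F)
    (delta : R) (hdelta : (0 < delta%:E <= NCP_separation N F)%E)
    (p : R) (hp : 1 <= p) :
  complementarity_deflation_operator N F delta%:E (bump_deflation N delta p).
Proof.
have d0 : 0 < delta by case/andP: hdelta; rewrite lte_fin.
have p0 : 0 <= p by rewrite (le_trans _ hp).
have dist_gt0 z s : z <> s -> 0 < N (z - s).
  by move=> zs; apply: is_norm_gt0 => // /subr0_eq.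
split => // s _; split.
- move=> z zP zs j; have d2 : 0 < delta / 2 by rewrite divr_gt0.
  (* A bound uniform in [k] is needed: positivity of each term would only give a nonnegative limit
     inferior. *)
  apply: (@lt_le_trans _ _ (expR (-1) / (delta / 2) `^ p)%:E).
    by rewrite lte_fin divr_gt0 ?expR_gt0 ?powR_gt0.
  apply: limn_einf_ge_near; near=> k; have [zk0 zks] := zP k.
  rewrite lee_fin (le_trans _ (ler_norm _))//.
  apply: bump_deflation_near_center => //; first exact: dist_gt0.
  by rewrite ltW//; near: k; exact: is_norm_cvg_near.
- move=> j z [z0 zB] zs; rewrite bump_deflation_sg_far ?dist_gt0// leNgt.
  (* A point of the orthant other than [s] and closer than [delta] would lie in the punctured
     ball. *)
  by apply/negP => zsd; apply: zB; split; rewrite ?lte_fin ?dist_gt0.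
- move=> j z [z0 zs]; rewrite lte_fin => zsd.
  rewrite [leRHS]gtr0_sg; last exact: bump_deflation_gt0.
  (* The sign of [z 0 j] is 0 or 1, hence at most 1. *)
  by have := z0 j; rewrite le_eqVlt => /predU1P[<-|/gtr0_sg ->]; rewrite ?sgr0.
Unshelve. all: by end_near. Qed.
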